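(* For each fixed integer $l\ge 1$, letting $P_l$ denote the path with $l$ edges, \[ \frac{l-1}{2}\,n\sim \mathrm{ex}(n,P_l)\le \mathrm{ex}^*(n,P_l)\le \left\lceil\frac{3l-2}{2}\right\rceil n, \] where $\sim$ refers to $n\to\infty$.
   Context: $\mathrm{ex}(n,F)$ is the usual Turán number: the maximum number of edges in an $n$-vertex graph containing no copy of $F$. $\mathrm{ex}^*(n,F)$ (the rainbow Turán number) is the maximum number of edges in an $n$-vertex graph that admits a proper edge-coloring containing no rainbow copy of $F$, i.e. no copy of $F$ all of whose edges receive different colors. *)

(* Defs.v *)
From HB Require Import structures.
From mathcomp Require Import all_boot all_order all_algebra.
From mathcomp Require Import all_classical all_reals all_analysis.

Set Implicit Arguments.
Unset Strict Implicit.
Unset Printing Implicit Defensive.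

Record sgraph (V : finType) := SGraph {
  edges : {set {set V}};
  edges_card2 : [forall e in edges, #|e| == 2]
}.

HB.instance Definition _ (V : finType) := [isSub for @edges V].
HB.instance Definition _ (V : finType) := [Finite of sgraph V by <:].

(* A copy of [F] in [G] is a not necessarily induced subgraph of [G] isomorphic
   to [F], given by an injection of the vertices. *)
Definition is_copy (U V : finType) (F : sgraph U) (G : sgraph V) (f : U -> V)
    : Prop :=
  injective f /\ forall e, e \in edges F -> f @: e \in edges G.

Definition has_copy (U V : finType) (F : sgraph U) (G : sgraph V) : Prop :=
  exists f : U -> V, is_copy F G f.

(* Only the values of a colouring on [edges G] matter. *)
Definition proper_edge_coloring (V : finType) (G : sgraph V)
    (c : {set V} -> nat) : Prop :=
  forall e1 e2, e1 \in edges G -> e2 \in edges G ->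
    e1 != e2 -> e1 :&: e2 != finset.set0 -> c e1 <> c e2.

Definition has_rainbow_copy (U V : finType) (F : sgraph U) (G : sgraph V)
    (c : {set V} -> nat) : Prop :=
  exists f : U -> V, is_copy F G f /\
    forall e1 e2, e1 \in edges F -> e2 \in edges F ->
      e1 != e2 -> c (f @: e1) <> c (f @: e2).

(* If every [n]-vertex graph contains [F], the maximum is over the empty family
   and has value 0; this cannot happen as soon as [F] has an edge. *)
Definition ex (n : nat) (U : finType) (F : sgraph U) : nat :=
  \max_(G : sgraph 'I_n | `[< ~ has_copy F G >]) #|edges G|.

Definition ex_star (n : nat) (U : finType) (F : sgraph U) : nat :=
  \max_(G : sgraph 'I_n |
        `[< exists c : {set 'I_n} -> nat,
              proper_edge_coloring G c /\ ~ has_rainbow_copy F G c >])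
    #|edges G|.

(* [lift ord0 i] has value [i.+1]. *)
Definition path_edges (l : nat) : {set {set 'I_l.+1}} :=
  [set [set widen_ord (leqnSn l) i; lift ord0 i] | i : 'I_l]%SET.

Lemma path_edges_card2 (l : nat) : [forall e in path_edges l, #|e| == 2].
Proof.
apply/forall_inP => e /imsetP[i _ ->].
by rewrite cards2 -val_eqE /= /bump /= add1n neq_ltn ltnSn.
Qed.

(* The path with [l] edges, hence [l.+1] vertices. *)
Definition path_graph (l : nat) : sgraph 'I_l.+1 := SGraph (path_edges_card2 l).

(* Main.v *)
Require Import Defs.
From mathcomp Require Import all_boot all_order all_algebra.
From mathcomp Require Import all_classical all_reals all_analysis.
From mathcomp Require Import zify lra.
Import Order.TTheory GRing.Theory Num.Theory.
Import numFieldNormedType.Exports.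

Set Implicit Arguments.
Unset Strict Implicit.
Unset Printing Implicit Defensive.

(* Rainbow bound. Let [x ... z] be a rainbow path with [k] edges that cannot be
   extended at [x] or [z]. The neighbours of [x] joined to it by a colour not
   used on the path number at least [deg x - k], and all of them are on the
   path; for such a neighbour [y], the chord [x y] can replace the path edge
   entering [y], which frees the colour of that edge. The neighbours of [z]
   outside the path number at least [deg z - k], and they are joined to [z] by
   colours of the path, none of which can be freed by a chord at [x], as the
   rotated path could then be extended. Hence [deg x + deg z <= 3 k] if no
   rainbow path has [k + 1] edges. Deleting vertices of degree at most [K],
   where [3 l <= 2 K + 2], thus either exhausts the graph or reaches a subgraph
   that has a rainbow path with [l] edges.

   Turán bound (Erdős-Gallai). Delete vertices of degree less than [l / 2]. If
   there are none, a longest path closes into a cycle whose at most [l] vertices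
   form a union of components, and these components can be deleted. Disjoint
   cliques of order [l] show that the bound is asymptotically sharp. *)

(** * Rainbow paths *)

Definition rainbow_path (T : eqType) (e : rel T) (c : T -> T -> nat) x p :=
  [&& path e x p, uniq (x :: p) & uniq (pairmap c x p)].

Lemma last_rev_belast (T : Type) (x : T) p :
  last (last x p) (rev (belast x p)) = x.
Proof.
by case: p => //= y p; rewrite rev_cons last_rcons.
Qed.

Lemma pairmap_rev (T1 T2 : Type) (c : T1 -> T1 -> T2) x p :
  (forall u v, c u v = c v u) ->
  pairmap c (last x p) (rev (belast x p)) = rev (pairmap c x p).
Proof.
move=> csym; elim: p x => //= y p IHp x.
by rewrite !rev_cons -!cats1 pairmap_cat IHp /= last_rev_belast csym.
Qed.

Lemma rainbow_path_rcons (T : eqType) (e : rel T) (c : T -> T -> nat) x p w :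
  rainbow_path e c x p -> e (last x p) w -> w \notin x :: p ->
  c (last x p) w \notin pairmap c x p -> rainbow_path e c x (rcons p w).
Proof.
move=> /and3P[pP uP cP] ew wP cw; apply/and3P; split.
- by rewrite rcons_path pP.
- by rewrite -rcons_cons rcons_uniq wP.
- by rewrite -cats1 pairmap_cat cats1 rcons_uniq cw.
Qed.

Lemma rainbow_path_cons (T : eqType) (e : rel T) (c : T -> T -> nat) x p w :
  rainbow_path e c x p -> e w x -> w \notin x :: p ->
  c w x \notin pairmap c x p -> rainbow_path e c w (x :: p).
Proof.
move=> /and3P[pP uP cP] ew wP cw; apply/and3P; split.
- by rewrite /= ew.
- by rewrite cons_uniq wP.
- by rewrite /= cw.
Qed.

(* The chord [x y] replaces the edge entering [y], whose colour is freed. *)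
Lemma rainbow_path_rot (T : eqType) (e : rel T) (c : T -> T -> nat) x p1 y p2 :
  symmetric e -> (forall u v, c u v = c v u) ->
  rainbow_path e c x (p1 ++ y :: p2) -> e x y ->
  c x y \notin pairmap c x (p1 ++ y :: p2) ->
  let u := last x p1 in let q := rev (belast x p1) ++ y :: p2 in
  rainbow_path e c u q /\ c u y \notin pairmap c u q.
Proof.
move=> esym csym /and3P[pP uP cP] exy cxy u q.
have pu : perm_eq (u :: q) (x :: p1 ++ y :: p2).
  rewrite /u /q -cat_cons -rev_rcons -lastI -cat_cons perm_cat2r.
  by rewrite perm_rev.
rewrite /rainbow_path (perm_uniq pu) uP /= /q.
move: pP cP cxy; rewrite cat_path !pairmap_cat !cat_path /= -/u.
move=> /and3P[pP1 _ pP2] cP.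
rewrite mem_cat inE !negb_or => /and3P[cx1 cxu cx2].
have -> : path e u (rev (belast x p1)).
  by rewrite rev_path (eq_path (e' := e)) // => a b; rewrite esym.
rewrite last_rev_belast exy pP2 pairmap_rev //= -/u.
move: cP; rewrite !cat_uniq /= rev_uniq !negb_or.
move=> /and4P[-> /andP[cu1 h] cu2 ->].
rewrite !mem_rev mem_cat inE mem_rev !negb_or cu1 cu2 cx1 cx2 eq_sym cxu.
split=> //; rewrite !andbT; apply/hasPn => a /(hasPn h).
by rewrite /= mem_rev.
Qed.

Lemma rainbow_path_extend (T : finType) (e : rel T) (c : T -> T -> nat) x p :
  symmetric e -> irreflexive e -> (forall u v, c u v = c v u) ->
  (forall u v w, e u v -> e u w -> c u v = c u w -> v = w) ->
  rainbow_path e c x p -> 3 * size p < #|e x| + #|e (last x p)| ->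
  exists y q, size q = (size p).+1 /\ rainbow_path e c y q.
Proof.
move=> esym eirr csym cprop rP degs.
set C := pairmap c x p; set z := last x p.
case: (boolP [exists w, [&& e z w, w \notin x :: p & c z w \notin C]]).
  move=> /existsP[w /and3P[ew wP cw]]; exists x, (rcons p w).
  by rewrite size_rcons; split=> //; apply: rainbow_path_rcons.
rewrite negb_exists => /forallP outz.
case: (boolP [exists w, [&& e x w, w \notin x :: p & c x w \notin C]]).
  move=> /existsP[w /and3P[ew wP cw]]; exists w, (x :: p).
  by split=> //; apply: rainbow_path_cons; rewrite // 1?esym 1?csym.
rewrite negb_exists => /forallP outx.
pose Y := enum [pred y | e x y & c x y \notin C].
pose W := enum [pred w | e z w & w \notin x :: p].
have Yp y : y \in Y -> y \in p.
  rewrite mem_enum inE => /andP[exy cxy].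
  have := outx y; rewrite exy cxy andbT /= negbK inE => /orP[/eqP yx|//].
  by rewrite yx eirr in exy.
(* The colour of the path edge entering [y]: [C] is aligned with [p], not with [x :: p]. The default
   0 is never reached on [Y], which is contained in [p]. *)
pose freed y := nth 0 C (index y p).
have sC : size C = size p by rewrite size_pairmap.
(* If the chord to [y] frees the colour of [z w], the rotated path still ends at [z] and extends to
   [w]. *)
case: (boolP [exists y in Y, [exists w in W, freed y == c z w]]).
  move=> /exists_inP[y yY /exists_inP[w wW /eqP fyw]].
  have yp := Yp y yY; move: yY wW; rewrite !mem_enum !inE.
  move=> /andP[exy cxy] /andP[ezw wP].
  have [_ /= /andP[_ up] _] := and3P rP.
  move: (rP) cxy fyw up wP ezw; rewrite /freed /C /z.
  rewrite -[p in rainbow_path _ _ _ p](cat_take_drop (index y p)).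
  have dp : drop (index y p) p = y :: drop (index y p).+1 p.
    by rewrite (drop_nth y) ?nth_index ?index_mem.
  set p1 := take _ p; set p2 := drop (index y p).+1 p.
  have pE : p = p1 ++ y :: p2 by rewrite /p2 -dp cat_take_drop.
  rewrite dp -/p2 => {}rP cxy fyw up wP ezw.
  rewrite pE in cxy.
  have [rQ fQ] := rainbow_path_rot esym csym rP exy cxy.
  have fE : nth 0 (pairmap c x p) (index y p) = c (last x p1) y.
    rewrite {1}pE pairmap_cat nth_cat size_pairmap size_takel ?index_size //.
    by rewrite ltnn subnn.
  exists (last x p1), (rcons (rev (belast x p1) ++ y :: p2) w); split.
    rewrite size_rcons size_cat size_rev size_belast /=.
    by rewrite [in RHS]pE size_cat.
  have lE : last (last x p1) (rev (belast x p1) ++ y :: p2) = last x p.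
    by rewrite last_cat /= pE last_cat.
  apply: rainbow_path_rcons; rewrite // ?lE //.
    apply: contra wP; rewrite -cat_cons -rev_rcons -lastI [in X in _ -> X]pE.
    by rewrite !mem_cat mem_rev inE orbA.
  by rewrite -fyw fE.
rewrite negb_exists_in => /forall_inP noYW.
have uC : uniq C by case/and3P: rP.
have up : uniq p by case/and3P: rP => _ /andP[].
(* The freed colours and the colours from [z] to [W] form disjoint subsets of [C]; no colour
   repeats, as [C] is duplicate-free and the colouring proper. *)
have YWC : size Y + size W <= size p.
  rewrite -sC -(size_map freed Y) -(size_map (c z) W) -size_cat.
  apply: uniq_leq_size.
    rewrite cat_uniq !map_inj_in_uniq ?enum_uniq //=.
    - rewrite andbT; apply/hasPn => _ /mapP[w wW ->]; apply/negP.
      case/mapP => y yY fE; have := noYW y yY.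
      by rewrite negb_exists_in => /forall_inP/(_ w wW); rewrite fE eqxx.
    - move=> v w; rewrite !mem_enum !inE => /andP[ev _] /andP[ew _].
      exact: cprop ev ew.
    - move=> y1 y2 /Yp y1p /Yp y2p /eqP.
      rewrite /freed nth_uniq ?sC ?index_mem // => /eqP iE.
      by rewrite -(nth_index x y1p) iE nth_index.
  move=> a; rewrite mem_cat => /orP[] /mapP[y yY ->].
    by rewrite mem_nth // sC index_mem Yp.
  move: yY; rewrite mem_enum inE => /andP[ezy yP].
  by have := outz y; rewrite ezy yP /= negbK.
(* Neighbours of [x] outside [Y] are reached by distinct colours of [C]. *)
have degx : #|e x| <= size Y + size p.
  rewrite -(cardID [pred y | c x y \notin C] (e x)) leq_add //.
    rewrite -cardE; apply: eq_leq; apply: eq_card => y.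
    by rewrite !inE.
  rewrite cardE -(size_map (c x)) -sC uniq_leq_size //.
    rewrite map_inj_in_uniq ?enum_uniq // => v w.
    rewrite !mem_enum !inE => /andP[_ ev] /andP[_ ew].
    exact: cprop ev ew.
  by move=> _ /mapP[y + ->]; rewrite mem_enum !inE negbK => /andP[].
(* Neighbours of [z] outside [W] are path vertices other than [z]. *)
have degz : #|e z| <= size W + size p.
  rewrite -(cardID [pred y | y \notin x :: p] (e z)) leq_add //.
    rewrite -cardE; apply: eq_leq; apply: eq_card => y.
    by rewrite !inE.
  rewrite cardE -(size_belast x p) uniq_leq_size ?enum_uniq // => y.
  rewrite mem_enum !inE negbK => /andP[yP ezy].
  have : y \in x :: p by rewrite inE.
  rewrite lastI mem_rcons inE => /orP[/eqP yz|//].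
  by move: ezy; rewrite yz unfold_in eirr.
move: degs; rewrite -/z; lia.
Qed.

(** * Arc counts and vertex deletion *)

(** The vertex type stays [T], with vertices outside [S] isolated, so that a deletion only changes
    [S]. *)
Definition induced (T : finType) (e : rel T) (S : {set T}) : rel T :=
  fun x y => [&& x \in S, y \in S & e x y].

(* Counts ordered pairs, hence each edge twice. *)
Definition arcs (T : finType) (e : rel T) (S : {set T}) :=
  \sum_(x in S) \sum_(y in S) e x y.

Lemma induced_sym (T : finType) (e : rel T) (S : {set T}) :
  symmetric e -> symmetric (induced e S).
Proof. by move=> esym x y; rewrite /induced esym andbCA. Qed.

Lemma induced_irr (T : finType) (e : rel T) (S : {set T}) :
  irreflexive e -> irreflexive (induced e S).
Proof. by move=> eirr x; rewrite /induced eirr !andbF. Qed.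

Lemma induced_sub (T : finType) (e : rel T) (S : {set T}) :
  subrel (induced e S) e.
Proof. by move=> x y /and3P[]. Qed.

Lemma card_induced (T : finType) (e : rel T) (S : {set T}) x :
  x \in S -> #|induced e S x| = \sum_(y in S) e x y.
Proof.
move=> xS; rewrite -sum1_card big_mkcond [RHS]big_mkcond /=.
apply: eq_bigr => y _; rewrite unfold_in /induced xS.
by case: (y \in S); case: (e x y).
Qed.

Lemma last_induced (T : finType) (e : rel T) (S : {set T}) x p :
  x \in S -> path (induced e S) x p -> last x p \in S.
Proof.
case/lastP: p => // p y _; rewrite rcons_path last_rcons.
by case/andP=> _ /and3P[].
Qed.

(** By symmetry each crossing edge gives one arc in either direction, hence the factor 2. *)
Lemma arcsD (T : finType) (e : rel T) (S W : {set T}) :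
  symmetric e -> W \subset S ->
  arcs e S = arcs e W + arcs e (S :\: W)
             + 2 * \sum_(x in W) \sum_(y in S :\: W) e x y.
Proof.
move=> esym WS.
have split_sum (F : T -> nat) :
    \sum_(x in S) F x = \sum_(x in W) F x + \sum_(x in S :\: W) F x.
  rewrite (big_setID W) /=; congr (_ + _).
  by apply: eq_bigl => x; rewrite (finset.setIidPr WS).
have inner (A : {set T}) : \sum_(x in A) \sum_(y in S) e x y
    = \sum_(x in A) \sum_(y in W) e x y
      + \sum_(x in A) \sum_(y in S :\: W) e x y.
  by rewrite -big_split; apply: eq_bigr => x _; rewrite split_sum.
have cross : \sum_(x in S :\: W) \sum_(y in W) e x y
    = \sum_(x in W) \sum_(y in S :\: W) e x y.
  rewrite exchange_big; apply: eq_bigr => x _; apply: eq_bigr => y _.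
  by rewrite esym.
by rewrite /arcs split_sum !inner cross; lia.
Qed.

Lemma arcs_del (T : finType) (e : rel T) (S : {set T}) v :
  symmetric e -> irreflexive e -> v \in S ->
  arcs e S = arcs e (S :\ v) + 2 * #|induced e S v|.
Proof.
move=> esym eirr vS; rewrite (@arcsD _ _ _ [set v]) ?finset.sub1set //.
rewrite card_induced // [in RHS](bigD1 v) //= eirr add0n.
rewrite /arcs !big_set1 eirr add0n; congr (_ + 2 * _).
by apply: eq_bigl => y; rewrite !inE andbC.
Qed.

Lemma arcs_le_sq (T : finType) (e : rel T) (W : {set T}) :
  irreflexive e -> arcs e W <= #|W| * #|W|.-1.
Proof.
move=> eirr; rewrite /arcs -sum_nat_const; apply: leq_sum => x xW.
rewrite (bigD1 x) //= eirr add0n (cardD1 x) xW add1n /= -sum1_card.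
rewrite [X in _ <= X](eq_bigl (fun y => (y \in W) && (y != x))) /=.
  by apply: leq_sum => y _; case: (e x y).
by move=> y; rewrite !inE andbC.
Qed.

(** * Rainbow bound by vertex deletion *)

(** The path grows inside [S]: two ends of degree at least [(3 l - 2) / 2] have degree sum at least
    [3 l - 2], which exceeds [3 k] for all [k < l]. *)
Lemma rainbow_path_exists (T : finType) (e : rel T) (c : T -> T -> nat)
    (S : {set T}) l :
  symmetric e -> irreflexive e -> (forall u v, c u v = c v u) ->
  (forall u v w, e u v -> e u w -> c u v = c u w -> v = w) ->
  S != finset.set0 -> (forall v, v \in S -> 3 * l < 2 * #|induced e S v| + 3) ->
  exists x p, size p = l /\ rainbow_path e c x p.
Proof.
move=> esym eirr csym cprop /finset.set0Pn[x0 x0S] degS.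
have ind k : k <= l -> exists x p,
    [/\ x \in S, size p = k & rainbow_path (induced e S) c x p].
  elim: k => [|k IHk] kl; first by exists x0, [::].
  have [x [p [xS sp rP]]] := IHk (ltnW kl).
  have zS : last x p \in S by case/and3P: rP => /(last_induced xS).
  have [] := rainbow_path_extend (induced_sym S esym) (induced_irr S eirr)
    csym _ rP.
  - by move=> u v w /induced_sub uv /induced_sub uw; apply: cprop.
  - have := degS _ xS; have := degS _ zS; rewrite sp.
    by move: #|_| #|_| => a b; lia.
  move=> y [q [sq rQ]]; exists y, q; split=> //; last by rewrite sq sp.
  case: q sq rQ => // a q _ /and3P[/= /andP[+ _] _ _].
  by case/and3P.
have [x [p [_ sp /and3P[pP uP cP]]]] := ind l (leqnn l).
exists x, p; split=> //; rewrite /rainbow_path uP cP !andbT.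
exact: (sub_path (@induced_sub _ e S)) pP.
Qed.

Lemma rainbow_arcs_le (T : finType) (e : rel T) (c : T -> T -> nat) l K
    (S : {set T}) :
  symmetric e -> irreflexive e -> (forall u v, c u v = c v u) ->
  (forall u v w, e u v -> e u w -> c u v = c u w -> v = w) ->
  3 * l <= 2 * K + 2 ->
  (forall x p, size p = l -> ~~ rainbow_path e c x p) ->
  arcs e S <= 2 * K * #|S|.
Proof.
move=> esym eirr csym cprop lK norb.
have [n] := ubnP #|S|; elim: n S => // n IHn S cS.
case: (boolP [exists v in S, #|induced e S v| <= K]).
  move=> /exists_inP[v vS degv]; rewrite (arcs_del esym eirr vS).
  have := cardsD1 v S; rewrite vS => cE.
  have /IHn : #|S :\ v| < n by lia.
  by rewrite cE; nia.
rewrite negb_exists_in => /forall_inP degS.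
have [->|S0] := eqVneq S finset.set0; first by rewrite /arcs big_set0.
have [|x [p [sp rP]]] := rainbow_path_exists (l := l) esym eirr csym cprop S0.
  by move=> v vS; have := degS v vS; rewrite -ltnNge; lia.
by have := norb x p sp; rewrite rP.
Qed.

(** * The Erdős-Gallai bound *)

(* Pigeonhole yields consecutive [u], [y] on the path with chords [x y] and
   [u z], where [z] is its end: going from [x] to [u], then [z], then back to
   [y] and [x] is a cycle. *)
Lemma crossing_cycle (T : finType) (e : rel T) x p :
  symmetric e -> path e x p ->
  {subset e x <= p} -> {subset e (last x p) <= belast x p} ->
  size p < #|e x| + #|e (last x p)| ->
  exists2 q, cycle e q & perm_eq q (x :: p).
Proof.
move=> esym pP xp zp degs; set z := last x p in zp degs *.
pose k := size p.
have card_index (a : pred T) (s : seq T) : size s = k -> {subset a <= s} ->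
    #|a| <= #|[pred i : 'I_k | a (nth x s i)]|.
  move=> ss as_; rewrite cardE -(size_image (fun i : 'I_k => nth x s i)).
  apply: uniq_leq_size => [|v]; first exact: enum_uniq.
  rewrite mem_enum => av; have vs : index v s < k.
    by rewrite -ss index_mem as_.
  apply/fintype.imageP; exists (Ordinal vs); last by rewrite /= nth_index ?as_.
  by rewrite inE /= nth_index ?as_.
have := card_index _ _ erefl xp.
have := card_index _ _ (size_belast x p) zp.
set B := [pred i | _]; set A := [pred i | e x _] => cB cA.
have : 0 < #|[predI A & B]|.
  have := cardUI A B; have := max_card [predU A & B]; rewrite card_ord.
  by move: degs cA cB; rewrite -/k; do 6!move: #|_| => ?; lia.
(* The index [i] is that of [y] in [p] and of its predecessor [u] in [belast x p]. *)
case/card_gt0P => i /andP[]; rewrite !inE /= => exy ezu.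
move: pP exy ezu; rewrite -[p in path _ _ p](cat_take_drop i).
rewrite (drop_nth x) //; set p1 := take i p; set p2 := drop i.+1 p.
set y := nth x p i => + exy.
have pE : p = p1 ++ y :: p2 by rewrite -drop_nth // cat_take_drop.
have sp1 : size p1 = i by rewrite size_takel // ltnW.
have zE : z = last y p2 by rewrite /z pE last_cat.
rewrite pE belast_cat nth_cat size_belast sp1 ltnn subnn /=.
rewrite cat_path /= => /and3P[pP1 _ pP2] ezu.
exists (x :: p1 ++ rev (y :: p2)); last first.
  by rewrite -!cat_cons perm_cat2l perm_rev.
rewrite /= rcons_cat cat_path pP1 lastI rev_rcons -zE /= esym ezu /=.
rewrite rcons_path zE last_rev_belast esym exy andbT rev_path.
by rewrite (eq_path (e' := e)) // => a b; rewrite esym.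
Qed.

(** Serves to choose a longest path: some path has [k] edges, none has [k + 1]. *)
Lemma first_failure (P : nat -> Prop) l :
  P 0 -> ~ P l -> exists2 k, k < l & P k /\ ~ P k.+1.
Proof.
move=> P0; elim: l => [//|l IHl] Pl1.
have [Pl|/IHl[k kl Pk]] := pselect (P l); first by exists l.
by exists k; first exact: ltnW.
Qed.

(* A longest path of such a graph closes into a cycle, and no edge leaves the
   cycle since otherwise it would open up into a longer path. *)
Lemma small_component (T : finType) (e : rel T) (S : {set T}) l :
  symmetric e -> irreflexive e -> S != finset.set0 ->
  (forall x p, size p = l -> path e x p -> ~~ uniq (x :: p)) ->
  (forall v, v \in S -> l <= 2 * #|induced e S v|) ->
  exists W : {set T}, [/\ W \subset S, 0 < #|W| <= l &
    forall x y, x \in W -> y \in S -> e x y -> y \in W].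
Proof.
move=> esym eirr /finset.set0Pn[x0 x0S] nopath degS.
pose upath k := exists x p,
  [/\ x \in S, size p = k, path (induced e S) x p & uniq (x :: p)].
have [] := @first_failure upath l; first by exists x0, [::].
  move=> [x [p [_ sp pP uP]]]; have := nopath x p sp; rewrite uP.
  by move=> /(_ (sub_path (@induced_sub _ e S) pP)).
move=> k kl [[x [p [xS sp pP uP]]] longest].
have zS := last_induced xS pP.
have isym := induced_sym S esym.
(* By the choice of [k], every neighbour of the first vertex of a longest path lies on it; reversal
   covers the last vertex. *)
have longer y q v : size q = k -> path (induced e S) y q -> uniq (y :: q) ->
    induced e S v y -> v \in y :: q.
  move=> sq qP uq vy; apply: contraT => vq; case: longest; exists v, (y :: q).
  rewrite /= sq vy qP -/(uniq (y :: q)) uq -/(v \in y :: q) vq.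
  by case/and3P: vy.
have [|||q qC pq] := crossing_cycle isym pP.
- move=> v xv; have := longer x p v sp pP uP; rewrite isym => /(_ xv).
  rewrite inE => /orP[/eqP vx|//].
  by move: xv; rewrite vx unfold_in /induced eirr !andbF.
- move=> v zv.
  have := longer (last x p) (rev (belast x p)) v.
  rewrite size_rev size_belast rev_path -rev_rcons -lastI rev_uniq isym.
  rewrite (eq_path (e' := induced e S)) => [/(_ sp pP uP zv)|a b]; last first.
    by rewrite isym.
  rewrite mem_rev lastI mem_rcons inE => /orP[/eqP vz|//].
  by move: zv; rewrite vz unfold_in /induced eirr !andbF.
- have := degS _ xS; have := degS _ zS; rewrite sp.
  by move: #|_| #|_| => a b; lia.
(* The cycle opens into a longest path starting at any of its vertices, so [longer] applies to each
   of them. *)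
have rotq w : w \in q -> exists2 s, perm_eq (w :: s) q &
    path (induced e S) w (rcons s w).
  move=> /rot_to[i s rq]; exists s; first by rewrite -rq perm_rot.
  by move: qC; rewrite -(rot_cycle i) rq.
exists [set w in q]; split.
- apply/fintype.subsetP => w; rewrite inE => /rotq[[|a s] _] /=; last first.
    by case/andP=> /and3P[].
  by case/andP=> /and3P[].
- by rewrite cardsE (card_uniqP _) ?(perm_uniq pq) // (perm_size pq) /= sp.
move=> w t; rewrite !inE => wq tS ewt.
have [s sq] := rotq w wq; rewrite rcons_path => /andP[sP _].
have ss : size s = k.
  by have := perm_size (perm_trans sq pq); rewrite /= sp; case.
have wS : w \in S.
  have := rotq w wq => -[[|a r] _] /=; by case/andP=> /and3P[].
rewrite -(perm_mem sq); apply: longer => //.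
  by rewrite (perm_uniq sq) (perm_uniq pq).
by rewrite /induced tS wS esym.
Qed.

(** Either deletion costs at most [l - 1] arcs per vertex: [2 deg v < l] for a single vertex,
    [|W| (|W| - 1)] with [|W| <= l] for a closed set. *)
Lemma erdos_gallai_arcs (T : finType) (e : rel T) l (S : {set T}) :
  symmetric e -> irreflexive e ->
  (forall x p, size p = l -> path e x p -> ~~ uniq (x :: p)) ->
  arcs e S <= l.-1 * #|S|.
Proof.
move=> esym eirr nopath.
have [n] := ubnP #|S|; elim: n S => // n IHn S cS.
case: (boolP [exists v in S, 2 * #|induced e S v| < l]).
  move=> /exists_inP[v vS degv]; rewrite (arcs_del esym eirr vS).
  have := cardsD1 v S; rewrite vS => cE.
  have /IHn : #|S :\ v| < n by lia.
  by rewrite cE; nia.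
rewrite negb_exists_in => /forall_inP degS.
have [->|S0] := eqVneq S finset.set0; first by rewrite /arcs big_set0.
have [|W [WS /andP[W0 Wl] Wclosed]] := small_component esym eirr S0 nopath.
  by move=> v vS; have := degS v vS; rewrite -leqNgt.
rewrite (arcsD esym WS) [X in _ + 2 * X]big1 => [|x xW]; last first.
  apply: big1 => y; rewrite inE => /andP[yW yS].
  by apply/eqP; rewrite eqb0; apply: contra yW; apply: Wclosed xW yS.
have cE : #|S| = #|W| + #|S :\: W|.
  by rewrite -(cardsID W) (finset.setIidPr WS).
have /IHn : #|S :\: W| < n by lia.
by have := arcs_le_sq W eirr; rewrite cE; nia.
Qed.

(** * Graphs and copies of paths *)

Definition adj (V : finType) (G : sgraph V) : rel V :=
  fun x y => [set x; y]%SET \in edges G.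

Lemma adj_sym (V : finType) (G : sgraph V) : symmetric (adj G).
Proof. by move=> x y; rewrite /adj finset.setUC. Qed.

Lemma adj_irr (V : finType) (G : sgraph V) : irreflexive (adj G).
Proof.
move=> x; apply/negP => /(forall_inP (edges_card2 G)).
by rewrite finset.setUid cards1.
Qed.

(** Handshake: [y] and the edge [{x, y}] determine each other, so degrees count incident edges, and
    each edge has two ends. *)
Lemma arcs_adj (V : finType) (G : sgraph V) :
  arcs (adj G) [set: V]%SET = 2 * #|edges G|.
Proof.
have star x : \sum_(y in [set: V]%SET) adj G x y
    = \sum_(e in edges G) (x \in e : nat).
  transitivity #|[set [set x; y] | y in [set y | adj G x y]]%SET|.
    rewrite card_in_imset.
      rewrite -sum1_card big_mkcond [RHS]big_mkcond /=.
      by apply: eq_bigr => y _; rewrite !inE; case: (adj G x y).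
    move=> y z; rewrite !inE => xy xz /setP/(_ y); rewrite !inE eqxx orbT.
    move=> /esym/orP[/eqP yx|/eqP //].
    by move: xy; rewrite yx adj_irr.
  rewrite -sum1_card big_mkcond [RHS]big_mkcond /=.
  apply: eq_bigr => e _; case: imsetP => [[y + ->]|nex].
    by rewrite !inE eqxx /adj => ->.
  case: ifP => // eG; case: (boolP (x \in e)) => // xe; case: nex.
  have /cards2P[a [b [ab eE]]] := forall_inP (edges_card2 G) e eG.
  move: xe; rewrite eE !inE => /orP[]/eqP->.
    by exists b; rewrite // inE /adj -eE.
  by exists a; rewrite 1?finset.setUC // inE /adj finset.setUC -eE.
rewrite /arcs; under eq_bigr do rewrite star.
rewrite exchange_big /= mulnC -sum_nat_const; apply: eq_bigr => e eG.
rewrite -(eqP (forall_inP (edges_card2 G) e eG)) -sum1_card.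
by rewrite [RHS]big_mkcond /=; apply: eq_big => x; rewrite ?inE //; case: ifP.
Qed.

Lemma path_edge_image (V : finType) (x : V) p l (i : 'I_l) :
  (fun j : 'I_l.+1 => nth x (x :: p) j) @:
    [set widen_ord (leqnSn l) i; lift ord0 i]%SET
  = [set nth x (x :: p) i; nth x p i]%SET.
Proof. by rewrite finset.imsetU1 imset_set1. Qed.

Lemma path_is_copy (V : finType) (G : sgraph V) x p l :
  size p = l -> path (adj G) x p -> uniq (x :: p) ->
  is_copy (path_graph l) G (fun j : 'I_l.+1 => nth x (x :: p) j).
Proof.
move=> sp pP uP; split=> [i j /eqP|_ /imsetP[i _ ->]].
  by rewrite nth_uniq /= ?sp // => /eqP; exact: val_inj.
by rewrite path_edge_image; apply: (pathP x pP); rewrite sp.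
Qed.

Lemma rainbow_path_copy (V : finType) (G : sgraph V) (c : {set V} -> nat)
    x p l :
  size p = l ->
  rainbow_path (adj G) (fun u v => c [set u; v]%SET) x p ->
  has_rainbow_copy (path_graph l) G c.
Proof.
move=> sp /and3P[pP uP cP]; exists (fun j : 'I_l.+1 => nth x (x :: p) j).
split; first exact: path_is_copy.
move=> _ _ /imsetP[i _ ->] /imsetP[j _ ->] ij; rewrite !path_edge_image.
set g := (fun u v => c [set u; v]%SET) in cP.
rewrite -[c [set nth x (x :: p) i; _]%SET]/(g _ _).
rewrite -[c [set nth x (x :: p) j; _]%SET]/(g _ _).
rewrite -!(nth_pairmap x 0 g) ?sp //; apply/eqP.
rewrite nth_uniq ?size_pairmap ?sp //.
by apply: contra ij => /eqP/val_inj ->.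
Qed.

(** * Upper bounds and comparison of the two extremal numbers *)

Lemma ex_path_le n l : 2 * ex n (path_graph l) <= l.-1 * n.
Proof.
(* The maximum itself must be bounded, hence the rounded half. *)
suff : ex n (path_graph l) <= (l.-1 * n)./2 by lia.
apply/bigmax_leqP => G /asboolP nocopy.
suff : 2 * #|edges G| <= l.-1 * n by lia.
rewrite -arcs_adj -[n in _ * n]card_ord -cardsT.
apply: erdos_gallai_arcs (@adj_sym _ _) (@adj_irr _ _) _ => x p sp pP.
apply/negP => uP; apply: nocopy; exists (fun j : 'I_l.+1 => nth x (x :: p) j).
exact: path_is_copy.
Qed.

Lemma ex_star_path_le n l K :
  3 * l <= 2 * K + 2 -> ex_star n (path_graph l) <= K * n.
Proof.
move=> lK; apply/bigmax_leqP => G /asboolP[c [cprop nocopy]].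
suff : 2 * #|edges G| <= 2 * K * n by lia.
rewrite -arcs_adj -[n in _ * n]card_ord -cardsT.
apply: (rainbow_arcs_le (c := fun u v => c [set u; v]%SET) _
  (@adj_sym _ _) (@adj_irr _ _) _ _ lK).
- by move=> u v; rewrite finset.setUC.
- move=> u v w uv uw /eqP cE; apply/eqP; apply: contraTT cE => vw.
  apply/eqP; apply: cprop => //.
    apply/eqP => /setP/(_ v); rewrite !inE eqxx orbT (negbTE vw) orbF.
    by move=> /esym/eqP vu; move: uv; rewrite vu adj_irr.
  by apply/set0Pn; exists u; rewrite !inE eqxx.
- move=> x p sp; apply/negP => rP; apply: nocopy.
  exact: rainbow_path_copy rP.
Qed.

(** Giving each edge its own colour is proper, and without copies there are no rainbow ones. *)
Lemma ex_le_ex_star n (U : finType) (F : sgraph U) : ex n F <= ex_star n F.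
Proof.
apply/bigmax_leqP => G /asboolP nocopy; apply: leq_bigmax_cond.
apply/asboolP; exists (fun e => enum_rank e : nat); split.
  by move=> e1 e2 _ _ /eqP e12 _ /ord_inj/enum_rank_inj.
by move=> [f [fcopy _]]; apply: nocopy; exists f.
Qed.

(** * Lower bound by disjoint cliques *)

Definition clique_edges n l : {set {set 'I_n}} :=
  [set e : {set 'I_n} | (#|e| == 2) &&
     [forall x in e, forall y in e, x %/ l == y %/ l]]%SET.

Lemma clique_edges_card2 n l : [forall e in clique_edges n l, #|e| == 2].
Proof. by apply/forall_inP => e; rewrite inE => /andP[]. Qed.

(* Disjoint cliques on the blocks of [l] consecutive vertices, the last block
   possibly being shorter. *)
Definition clique_graph n l : sgraph 'I_n := SGraph (clique_edges_card2 n l).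

Lemma adj_clique n l (x y : 'I_n) :
  adj (clique_graph n l) x y = (x != y) && (x %/ l == y %/ l).
Proof.
rewrite /adj inE cards2; case: (x != y) => //=.
apply/forall_inP/idP => [h|/eqP xy].
  have /forall_inP -> // : [forall z in [set x; y]%SET, x %/ l == z %/ l].
    by apply: h; rewrite !inE eqxx.
  by rewrite !inE eqxx orbT.
move=> u; rewrite !inE => ux; apply/forall_inP => v; rewrite !inE => vx.
by case/orP: ux => /eqP->; case/orP: vx => /eqP->; rewrite ?xy.
Qed.

(** A path stays within one block, where residues modulo [l] separate vertices; its [l + 1] vertices
    do not fit. *)
Lemma clique_graph_path_free n l :
  0 < l -> ~ has_copy (path_graph l) (clique_graph n l).
Proof.
move=> l0 [f [finj fE]].
have block k (kl : k < l.+1) : f (Ordinal kl) %/ l = f ord0 %/ l.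
  elim: k kl => [|k IHk] kl; first by congr (f _ %/ l); apply: val_inj.
  have kl' : k < l by [].
  rewrite -(IHk (ltnW kl)).
  pose i := Ordinal kl'.
  have := fE [set widen_ord (leqnSn l) i; lift ord0 i]%SET.
  rewrite finset.imsetU1 imset_set1 => /(_ (imset_f _ _)) /=.
  rewrite -/(adj (clique_graph n l) _ _) adj_clique => /(_ isT)/andP[_ /eqP].
  have -> : lift ord0 i = Ordinal kl by apply: val_inj.
  have -> : widen_ord (leqnSn l) i = Ordinal (ltnW kl).
    by apply: val_inj.
  by [].
have fl i : f i %/ l = f ord0 %/ l by case: i.
pose g (i : 'I_l.+1) : 'I_l := Ordinal (ltn_pmod (f i) l0).
have /leq_card : injective g.
  move=> i j /(congr1 val) /= ij; apply/finj/val_inj.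
  by rewrite /= (divn_eq (f i) l) (divn_eq (f j) l) ij !fl.
by rewrite !card_ord ltnn.
Qed.

Lemma ex_path_ge n l :
  0 < l -> l.-1 * (n %/ l * l) <= 2 * ex n (path_graph l).
Proof.
move=> l0; apply: (@leq_trans (2 * #|edges (clique_graph n l)|)); last first.
  rewrite leq_mul2l; apply/orP; right.
  apply: (@leq_bigmax_cond _ _ (fun G => #|edges G|) (clique_graph n l)).
  apply/asboolP.
  exact: clique_graph_path_free.
(* Only the [m] vertices in full blocks are counted, each of degree at least [l - 1]. *)
rewrite -arcs_adj mulnC; set m := n %/ l * l.
have mn : m <= n by exact: leq_trunc_div.
pose M : {set 'I_n} := [set x : 'I_n | x < m]%SET.
have cM : m <= #|M|.
  have winj : injective (widen_ord mn).
    by move=> i j /(congr1 val) ij; apply: val_inj.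
  rewrite -[m in m <= _]card_ord -cardsT -(card_imset _ winj).
  by apply/subset_leq_card/fintype.subsetP => _ /imsetP[i _ ->]; rewrite inE /=.
apply: (@leq_trans (#|M| * l.-1)); first by rewrite leq_mul2r cM orbT.
rewrite /arcs (big_setID M) /= finset.setTI -sum_nat_const.
apply: leq_trans (leq_addr _ _); apply: leq_sum => x; rewrite inE => xm.
have xj (j : 'I_l) : x %/ l * l + j < n.
  apply: leq_trans mn; apply: (@leq_trans ((x %/ l).+1 * l)).
    by rewrite mulSn addnC ltn_add2r.
  by rewrite leq_mul2r ltn_divLR // xm orbT.
pose B := [set y : 'I_n | x %/ l == y %/ l]%SET.
have cB : l <= #|B|.
  have jinj : injective (fun j : 'I_l => Ordinal (xj j)).
    by move=> i j /(congr1 val) /= /addnI /val_inj.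
  rewrite -[l in l <= _]card_ord -cardsT -(card_imset _ jinj).
  apply/subset_leq_card/fintype.subsetP => _ /imsetP[j _ ->].
  by rewrite inE /= divnMDl // (divn_small (ltn_ord j)) addn0.
have : #|B :\ x|%SET = \sum_(y in [set: 'I_n]%SET) adj (clique_graph n l) x y.
  rewrite -sum1_card big_mkcond [RHS]big_mkcond /=; apply: eq_bigr => y _.
  by rewrite adj_clique !inE eq_sym; case: (_ && _).
have := cardsD1 x B; rewrite inE eqxx => BE <-.
by rewrite -ltnS prednK // -add1n -BE.
Qed.

(** * Real bounds and asymptotics *)

Local Open Scope classical_set_scope.
Local Open Scope ring_scope.

Theorem theorem9 (R : realType) (l : nat) (hl : (1 <= l)%N) :
  ((fun n : nat => (l%:R - 1) / 2 * n%:R : R^o) ~_\oo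
     (fun n : nat => (ex n (path_graph l))%:R : R^o)) /\
  (forall n : nat, (ex n (path_graph l) <= ex_star n (path_graph l))%N) /\
  (forall n : nat, (ex_star n (path_graph l))%:R <=
     (Num.ceil ((3 * l%:R - 2) / 2 : R))%:~R * n%:R :> R).
Proof.
split; last split=> [n|n]; last 2 first.
- exact: ex_le_ex_star.
- have l1 : 1 <= l%:R :> R by rewrite ler1n.
  set z := Num.ceil _.
  have z_ge : (3 * l%:R - 2) / 2 <= z%:~R :> R by exact: ceil_ge.
  have : 0 <= z by rewrite ceil_ge0; lra.
  (* The ceiling is nonnegative, hence a natural number [K]. *)
  case: z z_ge => // K; rewrite -pmulrn => K_ge _.
  rewrite -natrM ler_nat; apply: ex_star_path_le.
  by rewrite -(ler_nat R) natrD !natrM; lra.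
apply/eqaddoP => eps eps0.
(* Chosen so that [n >= N] gives [l <= eps (n - l)]. *)
have [N Nge] : exists N : nat, l%:R / eps + l%:R <= N%:R :> R.
  exists (Num.trunc (l%:R / eps + l%:R)).+1.
  by apply/ltW/truncnS_gt.
near=> n.
have nN : (N <= n)%N by near: n; exact: nbhs_infty_ge.
rewrite -[X in `|X| <= _]/((l%:R - 1) / 2 * n%:R - (ex n (path_graph l))%:R).
have lE : l%:R - 1 = (l.-1)%:R :> R.
  by rewrite -[in LHS](prednK hl) -natr1 addrK.
have := ex_path_le n l; rewrite -(ler_nat R) !natrM.
(* The incomplete block has fewer than [l] vertices. *)
have : (l.-1 * n <= 2 * ex n (path_graph l) + l.-1 * l)%N.
  have := ex_path_ge n hl; have := ltn_ceil n hl; nia.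
rewrite -(ler_nat R) natrD !natrM lE.
set a := l.-1%:R; set x := (ex _ _)%:R => lo up.
have a0 : 0 <= a by exact: ler0n.
have nge : l%:R / eps + l%:R <= n%:R :> R by rewrite (le_trans Nge) ?ler_nat.
have leps : l%:R <= eps * (n%:R - l%:R) :> R.
  by rewrite mulrC -ler_pdivrMr // lerBrDr.
have x0 : 0 <= x by exact: ler0n.
rewrite [`|x|]ger0_norm // ger0_norm; last by lra.
(* The target follows from [a n - 2 x <= a l <= eps a (n - l) <= 2 eps x]. *)
have h1 := ler_wpM2l a0 leps.
have h2 : eps * (a * (n%:R - l%:R)) <= eps * (2 * x).
  by rewrite ler_pM2l //; lra.
lra.
Unshelve. all: by end_near. Qed.
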